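(* Let $M$ be a paving matroid of rank $r$ on ground set $[n]$, let $\mathcal{H}$ be its set of hyperplanes, and for $r\le s\le n-1$ let $\mathcal{H}_s=\{H\in\mathcal{H}: |H|=s\}$. Then for every nonnegative integer $t$, \[ \mathrm{ehr}_{M}(t)=\mathrm{ehr}_{U_{r,n}}(t)-\sum_{s=r}^{n-1}|\mathcal{H}_s|\frac{n-s}{(n-1)!}\binom{t-1+n-s}{n-s}\tilde\phi_{r,s,n}(t), \] where \[ \tilde{\phi}_{r,s,n}(t)=\sum_{i=0}^{s-r}(-1)^i\binom{s}{i}\sum_{\ell=0}^{s-1}(n-2-\ell)!\,\ell!\binom{s-2-\ell-i+t(s-r-i+1)}{s-1-\ell}\binom{s-1-i+t(s-r-i)}{\ell}. \]
   Context: A matroid of rank $r$ is paving if every circuit has cardinality at least $r$. A hyperplane is a flat of rank $r-1$. $U_{r,n}$ is the uniform matroid on $[n]$ whose bases are all $r$-subsets. The base polytope of $M$ on $[n]$ is $\mathcal{P}_M=\mathrm{conv}\{\sum_{i\in B}\mathbf{e}_i: B\text{ a basis}\}\subset\mathbb{R}^n$ and $\mathrm{ehr}_M(t)=|t\mathcal{P}_M\cap\mathbb{Z}^n|$ for nonnegative integers $t$. Binomial coefficients $\binom{x}{k}$ with arbitrary integer top $x$ and integer $k\ge 0$ mean $x(x-1)\cdots(x-k+1)/k!$. *)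

(* Defs.v *)
From HB Require Import structures.
From mathcomp Require Import all_boot all_order all_algebra finmap.
From mathcomp Require Import classical_sets functions cardinality reals interval_inference convex.

Set Implicit Arguments.
Unset Strict Implicit.
Unset Printing Implicit Defensive.

Import Order.TTheory GRing.Theory Num.Theory.

Local Open Scope classical_set_scope.
Local Open Scope ring_scope.

Record matroid (E : finType) := Matroid {
  indep : {set {set E}};
  indep0 : finset.set0 \in indep;
  indepS : forall A B : {set E}, A \subset B -> B \in indep -> A \in indep;
  indep_augment : forall A B : {set E},
    A \in indep -> B \in indep -> (#|A| < #|B|)%N ->
    exists2 x, x \in (B :\: A)%SET & (x |: A)%SET \in indep }.

Section MatroidNotions.
Variables (E : finType) (M : matroid E).
Implicit Types A B C F : {set E}.

Definition basis B : bool := maxset (fun A => A \in indep M) B.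

Definition circuit C : bool := minset (fun A => A \notin indep M) C.

Definition rk A : nat := (\max_(I in indep M | I \subset A) #|I|)%N.

Definition mrank : nat := rk [set: E]%SET.

Definition flat F : bool := [forall x, (x \notin F) ==> (rk F < rk (x |: F)%SET)%N].

(* Stating "rank r - 1" with a successor means that a matroid of rank 0 has no
   hyperplane. *)
Definition hyperplane F : bool := flat F && ((rk F).+1 == mrank).

Definition hyperplanes_of_size (s : nat) : {set {set E}} :=
  [set F | hyperplane F & #|F| == s]%SET.

Definition paving : Prop := forall C, circuit C -> (mrank <= #|C|)%N.

End MatroidNotions.

Section Uniform.
Variables (n r : nat).

Definition uniform_indep : {set {set 'I_n}} := [set A : {set 'I_n} | #|A| <= r]%SET%N.

Lemma uniform_indep0 : finset.set0 \in uniform_indep.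
Proof. by rewrite inE cards0. Qed.

Lemma uniform_indepS (A B : {set 'I_n}) :
  A \subset B -> B \in uniform_indep -> A \in uniform_indep.
Proof. by rewrite !inE => /subset_leq_card; exact: leq_trans. Qed.

Lemma uniform_indep_augment (A B : {set 'I_n}) :
  A \in uniform_indep -> B \in uniform_indep -> (#|A| < #|B|)%N ->
  exists2 x, x \in (B :\: A)%SET & (x |: A)%SET \in uniform_indep.
Proof.
rewrite !inE => _ Br AB; have /finset.set0Pn[x xBA] : (B :\: A)%SET != finset.set0.
  by rewrite finset.setD_eq0; apply: contraL AB => /subset_leq_card; rewrite -leqNgt.
exists x => //; move: xBA; rewrite !inE => /andP[xA _].
by rewrite cardsU1 xA (leq_trans AB Br).
Qed.

Definition uniform : matroid 'I_n :=
  Matroid uniform_indep0 uniform_indepS uniform_indep_augment.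

Lemma uniform_basisE (B : {set 'I_n}) :
  (r <= n)%N -> basis uniform B = (#|B| == r).
Proof.
move=> rn; apply/maxsetP/eqP => [[]|Br]; rewrite inE.
  move=> Br Bmax; apply/eqP; rewrite eqn_leq Br /= leqNgt; apply/negP => ltBr.
  have /finset.set0Pn[x] : (~: B)%SET != finset.set0.
    by rewrite -card_gt0 cardsCs finset.setCK card_ord subn_gt0 (leq_trans ltBr rn).
  rewrite inE => xB; have := Bmax (x |: B)%SET.
  rewrite inE cardsU1 xB => /(_ ltBr (finset.subsetUr _ _)) BE.
  by move: xB; rewrite -BE finset.setU11.
split=> [|A]; first by rewrite Br.
by rewrite inE -Br => Ar BA; apply/eqP; rewrite eq_sym eqEcard BA.
Qed.

End Uniform.

Section Ehrhart.
Variables (R : realType) (n : nat).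

(* The vector \sum_(i in B) e_i. *)
Definition indicator (B : {set 'I_n}) : 'rV[R]_n := \row_i (i \in B)%:R.

Definition conv_hull (X : set 'rV[R]_n) : set 'rV[R]_n :=
  smallest (@convex_set R 'rV[R]_n) X.

Definition base_polytope (M : matroid 'I_n) : set 'rV[R]_n :=
  conv_hull [set indicator B | B in [set B | basis M B]].

Definition integer_points : set 'rV[R]_n :=
  range (fun z : 'rV[int]_n => map_mx intr z).

Definition dilate (t : nat) (X : set 'rV[R]_n) : set 'rV[R]_n :=
  [set t%:R *: x | x in X].

(* [fset_set] is only meaningful on finite sets: see [finite_lattice_points]. *)
Definition ehr (M : matroid 'I_n) (t : nat) : nat :=
  #|` fset_set (dilate t (base_polytope M) `&` integer_points)|%fset.

Lemma base_polytope_box (M : matroid 'I_n) :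
  base_polytope M `<=` [set x | forall i, 0 <= x ord0 i <= 1].
Proof.
apply: smallest_sub => [x y p|_ [B _ <-] i]; last first.
  by rewrite mxE; case: (i \in B); rewrite ?ler01 ?lexx.
move=> /set_mem xP /set_mem yP; apply/mem_set => i.
have [/andP[x0 x1] /andP[y0 y1]] := (xP i, yP i).
rewrite /convex.conv/= !mxE.
have p0 : 0 <= p%:num by [].
have p1 : p%:num <= 1 by [].
have q0 : 0 <= 1 - p%:num by rewrite subr_ge0.
rewrite /unstable.onem addr_ge0 ?mulr_ge0 //= -[leRHS](subrKC p%:num 1).
by rewrite lerD // ler_piMr.
Qed.

Lemma finite_lattice_points (M : matroid 'I_n) (t : nat) :
  finite_set (dilate t (base_polytope M) `&` integer_points).
Proof.
pose f (g : {ffun 'I_n -> 'I_t.+1}) : 'rV[R]_n := \row_i (g i)%:R.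
apply: (sub_finite_set (B := range f)); last exact/finite_image/finite_finset.
move=> _ [[x /base_polytope_box xP <-] [z _ zE]].
have zx i : (z ord0 i)%:~R = t%:R * x ord0 i by move/rowP/(_ i): zE; rewrite !mxE.
have zt i : (`|z ord0 i| < t.+1)%N /\ 0 <= z ord0 i.
  have /andP[x0 x1] := xP i.
  have z0 : 0 <= z ord0 i by rewrite -(ler0z R) zx mulr_ge0.
  split=> //; rewrite ltnS -(ler_nat R) natr_absz ger0_norm // zx.
  by rewrite ler_piMr.
exists [ffun i => inord `|z ord0 i|] => //; apply/rowP => i.
have [zi z0] := zt i; rewrite /f !mxE ffunE inordK //.
by rewrite natr_absz ger0_norm // zx.
Qed.

End Ehrhart.

(* x(x-1)...(x-k+1)/k! for an arbitrary integer x. *)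
Definition binz (x : int) (k : nat) : rat :=
  (\prod_(i < k) (x - i%:Z))%:~R / (k`!)%:R.

Lemma binz_nat (m k : nat) : binz m%:Z k = ('C(m, k))%:R.
Proof.
have E : \prod_(i < k) (m%:Z - i%:Z) = (m ^_ k)%:Z.
  have [mk|km] := ltnP m k.
    by rewrite ffact_small // (bigD1 (Ordinal mk)) //= subrr mul0r.
  rewrite ffact_prod -[RHS]natz natr_prod; apply: eq_bigr => i _.
  by rewrite natz subzn // (leq_trans (ltnW (ltn_ord i)) km).
by rewrite /binz E -bin_ffact -pmulrn natrM mulfK // pnatr_eq0 -lt0n fact_gt0.
Qed.

Definition phi (r s n t : nat) : rat :=
  \sum_(0 <= i < (s - r).+1) (-1) ^+ i * ('C(s, i))%:R *
    \sum_(0 <= l < s) ((n - 2 - l)`!)%:R * (l`!)%:R *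
      binz (s%:Z - 2 - l%:Z - i%:Z + t%:Z * (s%:Z - r%:Z - i%:Z + 1)) (s - 1 - l) *
      binz (s%:Z - 1 - i%:Z + t%:Z * (s%:Z - r%:Z - i%:Z)) l.

(* Main.v *)
(* The lattice points of [t P_M] are the natural vectors [y] with total sum [t r]
   and [y(A) <= t rk(A)] for all [A]: if some coordinate of such a [y] is neither [0]
   nor [t], submodularity makes the tight sets closed under intersection, so a
   minimal tight set containing such a coordinate contains two of them, [i] and [j],
   which no tight set separates; moving [y] along [e_i - e_j] in both directions
   until a new constraint becomes tight exhibits [y] as a convex combination of
   vectors with more tight constraints.

   When [M] is paving, the only relevant inequalities are [y(H) <= t (r - 1)] for
   hyperplanes [H]. Two distinct hyperplanes meet in at most [r - 2] elements, hence
   cannot both be violated, and the lattice points of [t P_U] outside [t P_M] are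
   counted hyperplane by hyperplane. If [#|H| = s], the coordinates outside [H] have
   sum [j < t], and replacing [y_i] by [t - y_i] on [H] gives coordinates with sum
   [t (s - r) + j]; both numbers of choices are coefficients of powers of
   [1 + X + ... + X^t]. The resulting sum over [j] is turned into the sum over [l]
   of the statement by induction on [t]. *)

Require Import Defs.
From mathcomp Require Import all_boot all_order all_algebra.
From mathcomp Require Import zify ring.

Set Implicit Arguments.
Unset Strict Implicit.
Unset Printing Implicit Defensive.

(** * Rank function *)

Lemma exists_subset_card (E : finType) (A : {set E}) k :
  k <= #|A| -> exists2 B : {set E}, B \subset A & #|B| = k.
Proof.
move=> kA; have : 0 < #|[set B : {set E} | B \subset A & #|B| == k]|.
  by rewrite cards_draws bin_gt0.
by case/card_gt0P => B; rewrite inE => /andP[BA /eqP cB]; exists B.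
Qed.

Section Rank.
Variables (E : finType) (M : matroid E).
Implicit Types A B I : {set E}.

Lemma card_indep_le_rk I A : I \in indep M -> I \subset A -> #|I| <= rk M A.
Proof.
move=> Ii IA; rewrite /rk.
by apply: (leq_bigmax_cond (F := fun I : {set E} => #|I|)); rewrite Ii.
Qed.

Lemma rk_witness A : exists I, [/\ I \in indep M, I \subset A & #|I| = rk M A].
Proof.
have /(eq_bigmax_cond (fun I : {set E} => #|I|)) :
    0 < #|[pred I | (I \in indep M) && (I \subset A)]|.
  by apply/card_gt0P; exists set0; rewrite inE indep0 sub0set.
by case=> I /andP[Ii IA] e; exists I; split.
Qed.

Lemma rk_leP A m :
  reflect (forall I, I \in indep M -> I \subset A -> #|I| <= m) (rk M A <= m).
Proof.
apply: (iffP idP) => [Am I Ii IA|h].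
  exact: leq_trans (card_indep_le_rk Ii IA) Am.
by have [I [Ii IA <-]] := rk_witness A; exact: h.
Qed.

Lemma rk_mono A B : A \subset B -> rk M A <= rk M B.
Proof.
move=> AB; apply/rk_leP => I Ii IA.
exact: card_indep_le_rk (subset_trans IA AB).
Qed.

Lemma rk_le_card A : rk M A <= #|A|.
Proof. by apply/rk_leP => I _ /subset_leq_card. Qed.

Lemma rk_indep I : I \in indep M -> rk M I = #|I|.
Proof.
by move=> Ii; apply/eqP; rewrite eqn_leq rk_le_card card_indep_le_rk.
Qed.

Lemma indep_of_rk A : rk M A = #|A| -> A \in indep M.
Proof.
have [I [Ii IA <-]] := rk_witness A.
by move=> e; have /eqP <- : I == A by rewrite eqEcard IA e leqnn.
Qed.

Lemma indep_extend I A : I \in indep M -> I \subset A ->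
  exists J, [/\ J \in indep M, I \subset J, J \subset A & #|J| = rk M A].
Proof.
move=> Ii IA; pose P J := [&& J \in indep M, I \subset J & J \subset A].
have PI : P I by rewrite /P Ii IA subxx.
case: (@arg_maxnP _ I P (fun J => #|J|) PI) => J /and3P[Ji IJ JA] Jmax.
exists J; split => //; apply/eqP; rewrite eqn_leq card_indep_le_rk //=.
have [K [Ki KA <-]] := rk_witness A; rewrite leqNgt; apply/negP => JK.
have [x /setDP[xK xJ] xJi] := indep_augment Ji Ki JK.
have : P (x |: J).
  rewrite /P xJi (subset_trans IJ) ?subsetUr //= subUset JA andbT sub1set.
  exact: (subsetP KA).
by move=> /Jmax; rewrite cardsU1 xJ /= add1n ltnn.
Qed.

(** Extend a maximum independent subset [I] of [A :&: B] to a maximum independent subset [J] of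
    [A :|: B]. The traces of [J] on [A] and [B] are independent, and their sizes add up to at least
    [#|J| + #|I|]. *)
Lemma rk_submod A B : rk M (A :|: B) + rk M (A :&: B) <= rk M A + rk M B.
Proof.
have [I [Ii IAB cI]] := rk_witness (A :&: B).
have [J [Ji IJ JAB cJ]] :=
  indep_extend Ii (subset_trans IAB (subset_trans (subsetIl A B) (subsetUl A B))).
have JAi : J :&: A \in indep M by apply: indepS Ji; exact: subsetIl.
have JBi : J :&: B \in indep M by apply: indepS Ji; exact: subsetIl.
apply: leq_trans (leq_add (card_indep_le_rk JAi (subsetIr _ _))
                          (card_indep_le_rk JBi (subsetIr _ _))).
rewrite -cardsUI -setIUr -setIIr (setIidPl JAB) cJ leq_add2l -cI.
by apply: subset_leq_card; rewrite subsetI IJ.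
Qed.

Lemma basisE B : basis M B = (B \in indep M) && (#|B| == mrank M).
Proof.
apply/maxsetP/andP => [[Bi Bmax]|[Bi /eqP Br]]; split => //.
  have [J [Ji BJ _ cJ]] := indep_extend Bi (subsetT B).
  by rewrite /mrank -cJ (Bmax J).
move=> A Ai BA; apply/eqP; rewrite eq_sym eqEcard BA /= Br.
exact: card_indep_le_rk (subsetT A).
Qed.

Lemma basis_exists : exists B, basis M B.
Proof.
have [B [Bi _ cB]] := rk_witness setT.
by exists B; rewrite basisE Bi cB eqxx.
Qed.

(** The matroid closure, which supplies a hyperplane containing a given set of rank [r - 1]. *)
Definition mclosure A : {set E} := [set x | rk M (x |: A) == rk M A].

Lemma sub_mclosure A : A \subset mclosure A.
Proof. by apply/subsetP => x xA; rewrite inE (setUidPr _) ?sub1set. Qed.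

Lemma rk_mclosure A : rk M (mclosure A) = rk M A.
Proof.
apply/eqP; rewrite eqn_leq (rk_mono (sub_mclosure A)) andbT leqNgt.
apply/negP => lt.
have [I [Ii IA cI]] := rk_witness A.
have [J [Ji JA cJ]] := rk_witness (mclosure A).
have [x /setDP[xJ xI] xIi] : exists2 x, x \in J :\: I & x |: I \in indep M.
  by apply: indep_augment => //; rewrite cI cJ.
have := subsetP JA _ xJ; rewrite inE => /eqP xA.
have := card_indep_le_rk xIi (setUS [set x] IA).
by rewrite cardsU1 xI cI xA add1n ltnn.
Qed.

Lemma flat_mclosure A : flat M (mclosure A).
Proof.
apply/forallP => x; apply/implyP => xA.
rewrite rk_mclosure (leq_trans _ (rk_mono (setUS [set x] (sub_mclosure A)))) //.
rewrite ltn_neqAle (rk_mono (subsetUr _ _)) andbT eq_sym.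
by move: xA; rewrite inE.
Qed.

(** A point of one hyperplane outside the other raises the rank of the latter, so their union has
    full rank and submodularity bounds the rank of the meet. *)
Lemma rk_hyperplane_meet H H' : hyperplane M H -> hyperplane M H' -> H != H' ->
  rk M (H :&: H') + 2 <= mrank M.
Proof.
have main (F G : {set E}) : hyperplane M F -> hyperplane M G ->
    ~~ (G \subset F) -> rk M (F :&: G) + 2 <= mrank M.
  move=> /andP[/forallP fF /eqP rF] /andP[_ /eqP rG] /subsetPn[x xG xF].
  have := implyP (fF x) xF.
  have : rk M (x |: F) <= rk M (F :|: G).
    by apply: rk_mono; rewrite subUset sub1set inE xG orbT subsetUl.
  have := rk_submod F G; lia.
move=> hH hH'; rewrite eqEsubset negb_and => /orP[] h; last exact: main.
by rewrite setIC; exact: main.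
Qed.

End Rank.

(** * Rank in a paving matroid *)

Section Paving.
Variables (E : finType) (M : matroid E).
Hypothesis pavM : paving M.
Implicit Types A H : {set E}.

Lemma paving_indep A : #|A| < mrank M -> A \in indep M.
Proof.
move=> Ar; apply/negPn/negP => Ad.
have [C minC CA] := @minset_exists _ (fun C => C \notin indep M) A Ad.
have := pavM minC; rewrite leqNgt => /negP; apply.
exact: leq_ltn_trans (subset_leq_card CA) Ar.
Qed.

(** For positive [r], all sets of size [r - 1] are independent. Hence a dependent set that is not of
    full rank has rank exactly [r - 1]. *)
Lemma paving_rk_ge A : minn #|A| (mrank M).-1 <= rk M A.
Proof.
have [r0|r0] := posnP (mrank M); first by rewrite r0 minn0.
have [Ar|rA] := ltnP #|A| (mrank M).
  by rewrite (rk_indep (paving_indep Ar)) geq_minl.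
have [B BA cB] : exists2 B : {set E}, B \subset A & #|B| = (mrank M).-1.
  by apply: exists_subset_card; lia.
rewrite (minn_idPr _); last by lia.
have Bi : B \in indep M by apply: paving_indep; lia.
by rewrite -cB -(rk_indep Bi) rk_mono.
Qed.

End Paving.

(** * Integer vectors satisfying the rank inequalities *)

Section RankInequalities.
Variables (E : finType) (M : matroid E) (t : nat).
Implicit Types (y : E -> nat) (A B : {set E}) (i j : E).

Definition rank_ineqs y : bool :=
  (\sum_i y i == t * mrank M) && [forall A : {set E}, \sum_(i in A) y i <= t * rk M A].

Lemma rank_ineqsP y :
  reflect (\sum_i y i = t * mrank M /\ forall A, \sum_(i in A) y i <= t * rk M A)
    (rank_ineqs y).
Proof. by apply: (iffP andP) => -[/eqP ? /forallP]. Qed.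

Definition tight y A := \sum_(i in A) y i == t * rk M A.

Lemma sum_setUI y A B :
  \sum_(i in A :|: B) y i + \sum_(i in A :&: B) y i
  = \sum_(i in A) y i + \sum_(i in B) y i.
Proof.
rewrite [X in X + _]big_mkcond [X in _ + X]big_mkcond -big_split /=.
rewrite [X in _ = X + _]big_mkcond [X in _ = _ + X]big_mkcond -big_split /=.
by apply: eq_bigr => i _; rewrite !inE; case: (i \in A); case: (i \in B); rewrite /= ?addn0 ?add0n.
Qed.

(** Uncrossing: submodularity and the inequalities for the union and the meet squeeze both of these
    into equalities. *)
Lemma tight_setI y A B : rank_ineqs y -> tight y A -> tight y B -> tight y (A :&: B).
Proof.
case/rank_ineqsP => _ yM /eqP tA /eqP tB.
have := sum_setUI y A B; have := rk_submod M A B.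
move: (yM (A :&: B)) (yM (A :|: B)); rewrite /tight tA tB; nia.
Qed.

Lemma tight_setT y : rank_ineqs y -> tight y setT.
Proof.
by case/rank_ineqsP => yT _; rewrite /tight -yT; apply/eqP/eq_bigl => i; rewrite inE.
Qed.

Lemma rank_ineqs_le y i : rank_ineqs y -> y i <= t.
Proof.
case/rank_ineqsP => _ /(_ [set i]); rewrite big_set1.
by have := rk_le_card M [set i]; rewrite cards1; nia.
Qed.

(* The pair is found in a minimal tight set containing a coordinate that is
   neither [0] nor [t]. *)
Lemma inseparable_pair y i0 : rank_ineqs y -> 0 < y i0 < t ->
  exists i j, [/\ i != j, 0 < y i, 0 < y j &
                  forall A, tight y A -> (i \in A) = (j \in A)].
Proof.
move=> yM y0; pose fr i := 0 < y i < t.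
pose P A := tight y A && [exists i in A, fr i].
have PT : P setT.
  by rewrite /P tight_setT //; apply/existsP; exists i0; rewrite inE /fr y0.
case: (@arg_minnP _ setT P (fun A => #|A|) PT) => A /andP[tA /existsP[i /andP[iA fi]]] Amin.
have [/existsP[j /and3P[jA ji fj]]|] :=
    boolP [exists j, [&& j \in A, j != i & fr j]]; last first.
  rewrite negb_exists => /forallP nof.
  (* If [i] were the only such coordinate in [A], all the others would be multiples of [t]; so is
     the tight total, hence [t] would divide [y i], contradicting [0 < y i < t]. *)
  have : t %| \sum_(k in A | k != i) y k.
    apply: dvdn_sum => k /andP[kA ki]; have := nof k; rewrite kA ki /fr /==> nk.
    have kt := rank_ineqs_le k yM.
    by have [->|->] : y k = 0 \/ y k = t by lia.
  move: tA; rewrite /tight (bigD1 i) //= => /eqP e d.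
  have : t %| y i by rewrite -(dvdn_addl _ d) e dvdn_mulr.
  by move/dvdnP => [q yi]; move: fi; rewrite /fr yi; case: q {yi} => // q; nia.
(* Minimality of [A]: a tight set [T] meeting [A] in such a coordinate cuts out a tight set that
   cannot be smaller than [A]. *)
have sub k T : k \in A -> fr k -> tight y T -> k \in T -> A \subset T.
  move=> kA fk tT kT; apply/setIidPl/eqP; rewrite eqEcard subsetIl Amin //.
  by rewrite /P tight_setI //; apply/existsP; exists k; rewrite inE kA kT.
exists i, j; split; rewrite 1?eq_sym //; [by case/andP: fi|by case/andP: fj|].
move=> T tT; apply/idP/idP => kT.
- exact: subsetP (sub _ _ iA fi tT kT) _ jA.
- exact: subsetP (sub _ _ jA fj tT kT) _ iA.
Qed.

(** The number of constraints, rank inequalities and nonnegativity alike, that are not tight at [y];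
    it is the measure of the induction towards vertices. *)
Definition slack y := #|[set A | ~~ tight y A]| + #|[set i | y i != 0]|.

Lemma sum_pred1 A i : \sum_(c in A) (c == i) = (i \in A).
Proof.
have [iA|iA] := boolP (i \in A); last first.
  by rewrite big1 // => c cA; case: eqP iA => // <-; rewrite cA.
by rewrite (bigD1 i) //= eqxx big1 // => c /andP[_ /negbTE ->].
Qed.

(** Units are moved from [j] to [i] one at a time. A tight set contains both or neither, and any
    other set has room for one unit, so no inequality breaks and no tight constraint is lost. The
    process stops because [y j] decreases, and its vanishing would itself lower [slack]. *)
Lemma push_to_tight y i j : rank_ineqs y -> i != j -> 0 < y i -> 0 < y j ->
    (forall A, tight y A -> (i \in A) = (j \in A)) ->
  exists k z, [/\ 0 < k, rank_ineqs z, slack z < slack y &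
                  forall c, z c + k * (c == j) = y c + k * (c == i)].
Proof.
move=> + ij; have [m] := ubnP (y j); elim: m y => // m IH y ym yM yi yj nsep.
pose z c := y c + (c == i) - (c == j).
have zE c : z c + (c == j) = y c + (c == i).
  by rewrite subnK //; case: eqP => // ->; lia.
have zA A : \sum_(c in A) z c + (j \in A) = \sum_(c in A) y c + (i \in A).
  rewrite -!sum_pred1 -!big_split /=; exact: eq_bigr.
have tz A : tight y A -> tight z A.
  by move=> tA; have := zA A; rewrite /tight nsep // => /addIn ->.
have z0 c : z c != 0 -> y c != 0.
  by rewrite /z; case: (eqVneq c i) => [->|]; rewrite ?subn_eq0; lia.
have zM : rank_ineqs z.
  case/rank_ineqsP: (yM) => yT yA; apply/rank_ineqsP; split => [|A].
    rewrite -yT; have := zA setT; rewrite !inE => /addIn.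
    by under eq_bigl do rewrite inE; under [RHS]eq_bigl do rewrite inE.
  have := zA A; have := yA A; rewrite leq_eqVlt => /orP[/nsep ->|]; last lia.
  by move=> /addIn ->.
have sub1 : [set A | ~~ tight z A] \subset [set A | ~~ tight y A].
  by apply/subsetP => A; rewrite !inE; apply/contra/tz.
have sub2 : [set c | z c != 0] \subset [set c | y c != 0].
  by apply/subsetP => c; rewrite !inE; exact: z0.
have [lt|] := boolP (slack z < slack y).
  by exists 1, z; split => // c; rewrite !mul1n.
rewrite -leqNgt /slack => le.
(* Without a drop of [slack], the tight sets and the support are unchanged, so the induction
   hypothesis applies to [z] with the same pair. *)
have /eqP e1 : [set A | ~~ tight z A] == [set A | ~~ tight y A].
  by rewrite eqEcard sub1; have := subset_leq_card sub2; lia.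
have /eqP e2 : [set c | z c != 0] == [set c | y c != 0].
  by rewrite eqEcard sub2; have := subset_leq_card sub1; lia.
have zj : 0 < z j by move/setP/(_ j): e2; rewrite !inE !lt0n => ->; rewrite -lt0n.
have zi : 0 < z i by move/setP/(_ i): e2; rewrite !inE !lt0n => ->; rewrite -lt0n.
have zyj : z j < y j by have := zE j; rewrite eqxx eq_sym (negbTE ij); lia.
have [|A tA|k [w [k0 wM ws wE]]] := IH z _ zM zi zj.
- exact: leq_trans zyj ym.
- by apply: nsep; move/setP/(_ A): e1; rewrite !inE tA => /esym/negbFE.
exists k.+1, w; split => // [|c]; first by rewrite /slack -e1 -e2.
have := zE c; have := wE c; nia.
Qed.

(** Every solution is reached from those with entries [0] and [t] by convex combinations. The
    weights are cleared of denominators: pushing by [k] one way and by [l] the other way puts [y] at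
    the barycentre with weights [l] and [k]. *)
Lemma rank_ineqs_ind (P : (E -> nat) -> Prop) :
    (forall y, rank_ineqs y -> (forall i, y i = 0 \/ y i = t) -> P y) ->
    (forall y z w k l, 0 < k -> 0 < l -> P z -> P w ->
       (forall c, l * z c + k * w c = (k + l) * y c) -> P y) ->
  forall y, rank_ineqs y -> P y.
Proof.
move=> P0 Pc y; have [m] := ubnP (slack y); elim: m y => // m IH y ym yM.
have [/existsP[i0 f0]|] := boolP [exists i, 0 < y i < t]; last first.
  rewrite negb_exists => /forallP nof; apply: P0 => // i.
  by have := nof i; have := rank_ineqs_le i yM; lia.
have [i [j [ij yi yj nsep]]] := inseparable_pair yM f0.
have [k [z [k0 zM zs zE]]] := push_to_tight yM ij yi yj nsep.
have [|A tA|l [w [l0 wM ws wE]]] := push_to_tight yM _ yj yi; rewrite 1?eq_sym //.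
  by rewrite nsep.
apply: (Pc y z w k l) => //; [apply: IH => //; lia|apply: IH => //; lia|].
move=> c; have := zE c; have := wE c.
by case: (c == i); case: (c == j); nia.
Qed.

(** The inequality for the support [B] reads [t * #|B| <= t * rk M B], which makes [B] independent;
    the total sum then gives its size. *)
Lemma rank_ineqs_vertex y : 0 < t -> rank_ineqs y -> (forall i, y i = 0 \/ y i = t) ->
  exists2 B, basis M B & forall i, y i = t * (i \in B).
Proof.
move=> t0 /rank_ineqsP[yT yA] y0t; pose B := [set i | y i == t].
have yE i : y i = t * (i \in B) by rewrite inE; case: (y0t i) => ->; case: eqP; lia.
have sB A : \sum_(i in A) y i = t * #|A :&: B|.
  under eq_bigr do rewrite yE.
  rewrite -big_distrr /= -sum1_card [in LHS]big_mkcond [in RHS]big_mkcond /=.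
  by congr (_ * _); apply: eq_bigr => i _; rewrite !in_setI; do !case: (i \in _).
exists B => //; rewrite basisE; apply/andP; split.
  apply: indep_of_rk; apply/eqP; rewrite eqn_leq rk_le_card.
  by rewrite -(leq_pmul2l t0) (leq_trans _ (yA B)) // sB setIid.
rewrite -(eqn_pmul2l t0) -yT -(setTI B) -sB; apply/eqP/eq_bigl => i.
by rewrite inE.
Qed.

End RankInequalities.

(** * Violated hyperplane inequalities in a paving matroid *)

Section PavingVectors.
Variables (E : finType) (M : matroid E) (t : nat).
Hypothesis pavM : paving M.
Let r := mrank M.

Definition exceeds (H : {set E}) (y : E -> nat) : bool := t * r.-1 < \sum_(i in H) y i.

Lemma sum_le_card (A : {set E}) (y : E -> nat) :
  (forall i, y i <= t) -> \sum_(i in A) y i <= t * #|A|.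
Proof.
by move=> yt; rewrite mulnC -sum_nat_const; apply: leq_sum => i _; exact: yt.
Qed.

(** The bound for [A] follows from [y i <= t] when [A] is independent and from the total sum when
    [A] has full rank. Otherwise [A] has rank [r - 1] and its closure is a hyperplane. *)
Lemma paving_rank_ineqs y : (forall i, y i <= t) -> \sum_i y i = t * r ->
  rank_ineqs M t y = [forall H : {set E}, hyperplane M H ==> ~~ exceeds H y].
Proof.
move=> yt yr; apply/rank_ineqsP/forallP => [[_ yA] H|yH].
  apply/implyP => /andP[_ /eqP rH]; rewrite /exceeds -leqNgt.
  by rewrite /r -rH /= yA.
split=> // A; have [Ai|Ad] := boolP (rk M A == #|A|).
  by rewrite (eqP Ai) sum_le_card.
have [rA|rA] := eqVneq (rk M A) r.
  rewrite rA -yr [leqRHS](bigID (mem A)) /=; exact: leq_addr.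
have rAr : rk M A < r by rewrite ltn_neqAle rA rk_mono ?subsetT.
have rA1 : (rk M A).+1 = r.
  have := paving_rk_ge pavM A; have := rk_le_card M A; rewrite -/r.
  by move: Ad rAr; rewrite neq_ltn; lia.
have := yH (mclosure M A).
rewrite /hyperplane flat_mclosure rk_mclosure rA1 eqxx /= /exceeds -leqNgt.
rewrite -rA1 /=; apply: leq_trans; rewrite [leqRHS](bigID (mem A)) /=.
rewrite [X in _ <= X + _](eq_bigl (mem A)) ?leq_addr // => i.
by apply: andb_idl; exact: (subsetP (sub_mclosure M A)).
Qed.

(** The union carries at most [t * r] and the meet at most [t * (r - 2)], too little for two sums
    that both exceed [t * (r - 1)]. *)
Lemma exceeding_hyperplane_unique y H H' : (forall i, y i <= t) -> \sum_i y i = t * r ->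
  hyperplane M H -> hyperplane M H' -> exceeds H y -> exceeds H' y -> H = H'.
Proof.
move=> yt yr hH hH' eH eH'; apply/eqP/negPn/negP => HH'.
have := rk_hyperplane_meet hH hH' HH'; rewrite -/r => rI.
have cI : #|H :&: H'| + 2 <= r by have := paving_rk_ge pavM (H :&: H'); rewrite -/r; lia.
have := sum_setUI y H H'; have := sum_le_card (H :&: H') yt.
have : \sum_(i in H :|: H') y i <= t * r.
  by rewrite -yr [leqRHS](bigID (mem (H :|: H'))) /= leq_addr.
move: eH eH'; rewrite /exceeds; nia.
Qed.

Lemma card_paving_vectors :
  #|[set y : {ffun E -> 'I_t.+1} | \sum_i y i == t * r]| =
  #|[set y : {ffun E -> 'I_t.+1} | rank_ineqs M t (fun i => y i)]| +
  \sum_(H | hyperplane M H)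
    #|[set y : {ffun E -> 'I_t.+1} |
        \sum_i y i == t * r & exceeds H (fun i => y i)]|.
Proof.
under eq_bigr => H _ do rewrite -sum1dep_card big_mkcond.
rewrite -!sum1dep_card exchange_big /= big_mkcond [X in _ = X + _]big_mkcond.
rewrite -big_split /=; apply: eq_bigr => y _.
have yt i : y i <= t by rewrite -ltnS.
case: eqP => [yr|yr]; last first.
  by rewrite big1 //; case: ifP => // /rank_ineqsP[].
rewrite paving_rank_ineqs // -big_mkcondr /=.
case: forallP => [yH|/forallP].
  rewrite big_pred0 // => H.
  by apply/negP => /andP[hH]; apply/negP/(implyP (yH H)).
rewrite negb_forall => /existsP[H]; rewrite negb_imply negbK => /andP[hH eH].
rewrite (big_pred1 H) // => H'; apply/andP/eqP => [[hH' eH']|-> //].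
exact: exceeding_hyperplane_unique eH' eH.
Qed.

Lemma hyperplane_card_lt H : hyperplane M H -> #|H| < #|E|.
Proof.
move=> /andP[_ /eqP rH]; rewrite -cardsT; apply: proper_card.
rewrite properE subsetT; apply/negP => /(rk_mono M).
by rewrite -/(mrank M) -rH ltnn.
Qed.

Lemma small_not_exceeds (H : {set E}) (y : E -> nat) :
  (forall i, y i <= t) -> #|H| < r -> exceeds H y = false.
Proof.
move=> yt Hr; apply/negbTE; rewrite /exceeds -leqNgt.
by rewrite (leq_trans (sum_le_card H yt)) // leq_mul2l; lia.
Qed.

End PavingVectors.

(** * A binomial convolution *)

Section BinomialConvolution.
Variables (a b K t : nat).
Hypothesis a_gt0 : 0 < a.

(** The factor [(l <= b)] makes [A b.+1] vanish, where truncated subtraction would leave a binomial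
    equal to 1; this ends the telescoping of [u]. *)
Let A l := (l <= b) * 'C(K + t - l, b - l).
Let u l := (a + b - l)`! * l`! * 'C(K, l) * A l.

(* Thanks to this recursion, [(t + a) G (t + 1) - t G t] telescopes in [l], where
   [G] is [bin_conv_sum] below. *)
Let telescope_step l : l <= b ->
  (a + b - l.+1)`! * l`! * 'C(K, l) * (a * A l + t * A l.+1) + u l.+1 = u l.
Proof.
move=> lb; rewrite /u.
have [lK|Kl] := leqP l K; last first.
  by rewrite (bin_small Kl) (bin_small (leqW Kl)) !(muln0, mul0n).
have AE : t * A l.+1 + (K - l) * A l.+1 = (b - l) * A l.
  rewrite -mulnDl /A lb mul1n; have [lb'|bl] := ltnP l b; last first.
    by rewrite (_ : b - l = 0); [rewrite mul0n muln0 | lia].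
  rewrite mul1n.
  have -> : b - l = (b - l.+1).+1 by lia.
  rewrite -mul_bin_diag; congr (_ * 'C(_, _)); lia.
have -> : a + b - l = (a + b - l.+1).+1 by lia.
have CE : (l.+1)`! * 'C(K, l.+1) = l`! * 'C(K, l) * (K - l).
  by rewrite [LHS]mulnC bin_ffact ffactnSr -bin_ffact [_ * l`!]mulnC.
rewrite -[_ * _ * 'C(K, l.+1)]mulnA CE factS.
have -> : (a + b - l.+1).+1 = a + (b - l) by lia.
move: (_ `!) (l`!) 'C(K, l) (A l) (A l.+1) AE => c f x y z e.
have -> : (a + (b - l)) * c * f * x * y = c * f * x * (a * y + (b - l) * y) by ring.
by rewrite -e; ring.
Qed.

Let bin_telescope :
  \sum_(l < b.+1) (a + b - l.+1)`! * l`! * 'C(K, l) * (a * A l + t * A l.+1)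
  = (a + b)`! * 'C(K + t, b).
Proof.
have S m : m <= b.+1 ->
  \sum_(l < m) (a + b - l.+1)`! * l`! * 'C(K, l) * (a * A l + t * A l.+1) + u m
  = u 0.
  elim: m => [|m IH] mb; first by rewrite big_ord0.
  by rewrite big_ord_recr /= -addnA telescope_step // IH // ltnW.
have := S b.+1 (leqnn _).
by rewrite [u b.+1]/u [A b.+1]/A ltnn mul0n muln0 addn0 => ->; rewrite /u /A !subn0 bin0 fact0 !muln1 mul1n.
Qed.

(** The inner sum of [phi] for [a = n - s] and [b = s - 1], with [K] the top of its last
    binomial. *)
Definition bin_conv_sum t' :=
  \sum_(l < b.+1) (a + b - l.+1)`! * l`! * 'C(K, l) * 'C(K + t' - l.+1, b - l).

Lemma bin_conv_sumS :
  (t + a) * bin_conv_sum t.+1 = (a + b)`! * 'C(K + t, b) + t * bin_conv_sum t.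
Proof.
rewrite -bin_telescope /bin_conv_sum !big_distrr -big_split /=.
apply: eq_bigr => l _; rewrite addnS subSS.
have lb : l <= b by rewrite -ltnS.
have [lK|Kl] := leqP l K; last by rewrite (bin_small Kl) !(muln0, mul0n).
(* Pascal's rule; [t = 0] is set apart because [K + t - l.+1] is truncated there when [l = K]. *)
have e : t * 'C(K + t - l, b - l) = t * A l.+1 + t * 'C(K + t - l.+1, b - l).
  have [->//|t0] := posnP t.
  rewrite -mulnDr /A; congr (_ * _).
  have -> : K + t - l = (K + t - l.+1).+1 by lia.
  have [lb'|bl] := ltnP l b; last first.
    by rewrite (_ : b - l = 0) ?bin0 ?mul0n; lia.
  have -> : b - l = (b - l.+1).+1 by lia.
  by rewrite binS mul1n addnC.
have AE : A l = 'C(K + t - l, b - l) by rewrite /A lb mul1n.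
rewrite -AE in e *.
move: (_ `!) (l`!) 'C(K, l) e => c f x e.
have -> : (t + a) * (c * f * x * A l) = c * f * x * (a * A l + t * A l) by ring.
by rewrite e; ring.
Qed.

End BinomialConvolution.

(** Induction on [t] through [bin_conv_sumS]. Here [K] stays fixed; only afterwards is it given a
    value that depends on [t]. *)
Lemma bin_convolution a b K t :
  (a.+1 + b)`! * (\sum_(j < t) 'C(j + a, a) * 'C(K + j, b))
  = a.+1 * 'C(t + a, a.+1) * bin_conv_sum a.+1 b K t.
Proof.
elim: t => [|t IH]; first by rewrite big_ord0 bin_small ?muln0.
rewrite big_ord_recr /= mulnDr IH.
rewrite mul_bin_left addnK addSn -mul_bin_diag /=.
have := @bin_conv_sumS a.+1 b K t isT; rewrite addnS.
move: (_ `!) (bin_conv_sum _ _ _ _) (bin_conv_sum _ _ _ _) => f G1 G2 e.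
by rewrite addSn [RHS]mulnAC e; ring.
Qed.

Import Order.TTheory GRing.Theory Num.Theory.
Local Open Scope ring_scope.

(** * Counting bounded vectors *)

Section GeometricPowers.
Variable t : nat.

Definition geom : {poly int} := \sum_(k < t.+1) 'X^k.

Let geomE : (1 - 'X) * geom = 1 - 'X^(t.+1).
Proof.
rewrite /geom -[1 - 'X^_]opprB subrX1 -opprB mulNr.
by congr (- (_ * _)).
Qed.

(** Congruence modulo ['X^N], which lets polynomials stand for power series. *)
Let congr_coef (N : nat) (f g : {poly int}) := forall k, (k < N)%N -> f`_k = g`_k.

Let congr_coefM N h f g : congr_coef N f g -> congr_coef N (h * f) (h * g).
Proof.
move=> fg k kN; rewrite !coefM; apply: eq_bigr => i _; congr (_ * _).
by apply: fg; rewrite (leq_ltn_trans (leq_subr _ _)).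
Qed.

(** The power series of [(1 - 'X)^-(s + 1)], truncated at degree [N]. *)
Let negbin (N s : nat) : {poly int} := \poly_(k < N) ('C(k + s, s))%:R.

Let negbinS N s : congr_coef N ((1 - 'X) * negbin N s.+1) (negbin N s).
Proof.
move=> k kN; rewrite mulrBl mul1r coefB coefXM !coef_poly kN.
case: k kN => [|k] kN /=; first by rewrite !add0n !binn subr0.
rewrite (ltn_trans _ kN) // addnS binS addSnnS natrD.
by rewrite addrAC subrr add0r.
Qed.

Let negbinP N s : congr_coef N ((1 - 'X) ^+ s.+1 * negbin N s) 1.
Proof.
elim: s => [|s IH].
  move=> k kN; rewrite expr1 mulrBl mul1r coefB coefXM !coef_poly kN !bin0 coef1.
  case: k kN => [|k] kN /=; first by rewrite subr0.
  by rewrite (ltn_trans _ kN) // bin0 subrr.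
move=> k kN; rewrite -IH // exprSr -mulrA.
by apply: congr_coefM kN => //; exact: negbinS.
Qed.

(* [geom ^+ s.+1 = (1 - 'X^(t+1)) ^+ s.+1 / (1 - 'X) ^+ s.+1] *)
Lemma coef_geomX s m :
  (geom ^+ s.+1)`_m =
  \sum_(i < s.+2) (-1) ^+ i * ('C(s.+1, i))%:R *
     ('C(m - i * t.+1 + s, s) * (i * t.+1 <= m)%N)%:R.
Proof.
have := @congr_coefM m.+1 (geom ^+ s.+1) _ _ (@negbinP m.+1 s) m (ltnSn m).
rewrite mulr1 => <-; rewrite mulrA -exprMn [geom * _]mulrC geomE.
rewrite exprBn mulr_suml coef_sum; apply: eq_bigr => i _.
rewrite expr1n mulr1 -exprM -mulrnAl.
rewrite -[(-1) ^+ i *+ _]mulr_natr.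
have -> : (-1) ^+ i * 'C(s.+1, i)%:R = ((-1) ^+ i * 'C(s.+1, i)%:R : int)%:P.
  by rewrite rmorphM rmorph_sign rmorph_nat.
rewrite -[in LHS]mulrA coefCM mulnC coefXnM coef_poly; congr (_ * _).
case: ltnP => h; first by rewrite muln0.
by rewrite muln1 ltnS leq_subr.
Qed.

End GeometricPowers.

Section BoundedVectors.
Variables (I : finType) (t : nat) (H : {set I}).

(** A generating function in two variables: the inner one records [t - y i] on [H], the outer one
    [y i] off [H]. Reversing the range of summation turns each inner factor into [geom t]. *)
Lemma card_split_sums u v :
  #|[set y : {ffun I -> 'I_t.+1} | (\sum_(i in H) (t - y i) == u)%N & (\sum_(i in ~: H) y i == v)%N]|%:R
  = (geom t ^+ #|H|)`_u * (geom t ^+ #|~: H|)`_v :> int.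
Proof.
pose F (i : I) (k : 'I_t.+1) : {poly {poly int}} :=
  if i \in H then ('X^(t - k))%:P else 'X^k.
have E : \prod_i \sum_k F i k = (geom t ^+ #|H|)%:P * (map_poly polyC (geom t)) ^+ #|~: H|.
  rewrite (bigID (mem H)) /=; congr (_ * _).
    rewrite rmorphXn -prodr_const; apply: eq_bigr => i iH.
    rewrite /F iH -rmorph_sum; congr (_%:P).
    rewrite /geom (reindex_inj rev_ord_inj) /=; apply: eq_bigr => k _.
    by rewrite subSS subKn // -ltnS.
  rewrite -prodr_const; apply: eq_big => [i|i iH]; first by rewrite inE.
  rewrite /F (negbTE iH) /geom rmorph_sum; apply: eq_bigr => k _.
  by rewrite /= map_polyXn.
have := congr1 (fun f : {poly {poly int}} => (f`_v)`_u) E.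
rewrite coefCM -rmorphXn coef_map /= coefMC => <-.
rewrite bigA_distr_bigA /= !coef_sum -sum1_card natr_sum big_mkcond /=.
apply: eq_bigr => y _.
have -> : \prod_i F i (y i) =
    ('X^(\sum_(i in H) (t - y i)))%:P * 'X^(\sum_(i in ~: H) y i).
  rewrite (bigID (mem H)) /=; congr (_ * _).
    rewrite -prodrXr rmorph_prod; apply: eq_bigr => i iH.
    by rewrite /F iH.
  rewrite -prodrXr; apply: eq_big => [i|i iH]; first by rewrite inE.
  by rewrite /F (negbTE iH).
rewrite coefCM coefXn inE [v == _]eq_sym.
case: (_ == v); last by rewrite andbF mulr0 coef0.
by rewrite mulr1 andbT coefXn [u == _]eq_sym; case: (_ == u).
Qed.

Lemma card_excess r : (0 < r <= #|H|)%N ->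
  #|[set y : {ffun I -> 'I_t.+1} | (\sum_i y i == t * r)%N & (t * r.-1 < \sum_(i in H) y i)%N]|%:R
  = \sum_(j < t) (geom t ^+ #|H|)`_(t * (#|H| - r) + j) * (geom t ^+ #|~: H|)`_j :> int.
Proof.
case/andP => r0 rs.
under eq_bigr => j _ do rewrite -card_split_sums.
rewrite -natr_sum; congr (_%:R).
under eq_bigr => j _ do rewrite -sum1dep_card big_mkcond.
rewrite -sum1dep_card big_mkcond exchange_big /=; apply: eq_bigr => y _.
have e1 : (\sum_i y i = \sum_(i in H) y i + \sum_(i in ~: H) y i)%N.
  by rewrite (bigID (mem H)) /=; congr addn; apply: eq_bigl => i; rewrite inE.
have e2 : (\sum_(i in H) (t - y i) + \sum_(i in H) y i = t * #|H|)%N.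
  rewrite -big_split /= mulnC -sum_nat_const; apply: eq_bigr => i _.
  by rewrite subnK // -ltnS.
have e3 : (t * r = t * r.-1 + t)%N by rewrite -mulnSr prednK.
have e4 : (t * #|H| = t * (#|H| - r) + t * r)%N by rewrite -mulnDr subnK.
rewrite e1; move: (\sum_(i in H) y i)%N (\sum_(i in ~: H) y i)%N e1 e2.
move: (\sum_(i in H) (t - y i))%N => A h b _ e2.
move: (t * #|H|)%N (t * _)%N (t * r)%N (t * _)%N e2 e3 e4 => x1 x2 x3 x4 e2 e3 e4.
rewrite -big_mkcond /=.
have [bt|tb] := ltnP b t; last first.
  rewrite big_pred0 => [|j]; last by have := ltn_ord j; lia.
  by case: ifP => //; lia.
case: ifP => h0.
  rewrite (big_pred1 (Ordinal bt)) // => j; rewrite inE -val_eqE /=; lia.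
by rewrite big_pred0 // => j; have := ltn_ord j; lia.
Qed.

End BoundedVectors.

(** * From coefficients to the formula for [phi] *)

(** The first integer top can be negative only when [l > K], and then the other binomial ['C(K, l)]
    is zero; so natural binomials suffice. *)
Lemma phi_bin_conv_sum a b r i t : (0 < t)%N -> (i + r <= b.+1)%N -> (0 < r)%N ->
  \sum_(0 <= l < b.+1) ((a + b.+2 - 2 - l)`!)%:R * (l`!)%:R *
      binz (b.+1%:Z - 2 - l%:Z - i%:Z + t%:Z * (b.+1%:Z - r%:Z - i%:Z + 1)) (b.+1 - 1 - l) *
      binz (b.+1%:Z - 1 - i%:Z + t%:Z * (b.+1%:Z - r%:Z - i%:Z)) l
  = (bin_conv_sum a.+1 b (t * (b.+1 - r - i) + (b - i)) t)%:R.
Proof.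
move=> t0 ir r0; set K := (_ + (b - i))%N.
rewrite big_mkord /bin_conv_sum natr_sum; apply: eq_bigr => l _.
have dE : b.+1%:Z - r%:Z - i%:Z = (b.+1 - r - i)%N%:Z by lia.
rewrite dE.
have -> : b.+1%:Z - 1 - i%:Z + t%:Z * (b.+1 - r - i)%N = K%:Z by rewrite /K; lia.
rewrite binz_nat.
have [lK|Kl] := leqP l K; last by rewrite bin_small // !(mulr0, muln0, mul0n).
have -> : b.+1%:Z - 2 - l%:Z - i%:Z + t%:Z * ((b.+1 - r - i)%N%:Z + 1)
   = (K + t - l.+1)%N%:Z by rewrite /K in lK *; lia.
rewrite binz_nat !natrM [RHS]mulrAC subn1 /=.
by have -> : (a + b.+2 - 2 - l = a.+1 + b - l.+1)%N by lia.
Qed.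

Lemma excess_count_formula r s n t : (0 < r <= s)%N -> (s < n)%N ->
  (\sum_(j < t) (geom t ^+ s)`_(t * (s - r) + j) * (geom t ^+ (n - s))`_j)%:~R
  = (n - s)%:R / ((n - 1)`!)%:R * binz (t%:Z - 1 + n%:Z - s%:Z) (n - s) * phi r s n t
  :> rat.
Proof.
case/andP => r0; case: s => [|b] rs; first by lia.
move=> sn; have [a ->] : exists a, n = (a + b.+2)%N by exists (n - b.+2)%N; lia.
have -> : (a + b.+2 - b.+1 = a.+1)%N by lia.
have -> : (a + b.+2 - 1 = a.+1 + b)%N by lia.
have -> : t%:Z - 1 + (a + b.+2)%N%:Z - b.+1%:Z = (t + a)%N%:Z by lia.
rewrite binz_nat.
have [->|t0] := posnP t.
  by rewrite big_ord0 bin_small // mulr0 mul0r.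
(* Since [j < t], only the term [i = 0] of [coef_geomX] survives. *)
have lowE (j : 'I_t) : (geom t ^+ a.+1)`_j = ('C(j + a, a))%:R.
  rewrite coef_geomX big_ord_recl mul0n subn0 leq0n muln1 expr0 bin0 !mul1r.
  rewrite big1 ?addr0 // => i _; rewrite [(_ <= _)%N](_ : _ = false) ?muln0 ?mulr0 //.
  by have := ltn_ord j; rewrite lift0; nia.
pose K i := (t * (b.+1 - r - i) + (b - i))%N.
have highE (j : 'I_t) : (geom t ^+ b.+1)`_(t * (b.+1 - r) + j)
    = \sum_(i < (b.+1 - r).+1) (-1) ^+ i * ('C(b.+1, i))%:R * ('C(K i + j, b))%:R.
  rewrite coef_geomX.
  rewrite (big_ord_widen_cond b.+2 xpredT
    (fun i => (-1) ^+ i * ('C(b.+1, i))%:R * ('C(K i + j, b))%:R)); last by lia.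
  rewrite [RHS]big_mkcond /=; apply: eq_bigr => i _.
  have tj := ltn_ord j.
  case: ifP => [ilt|ige]; last first.
    rewrite [(_ <= _ + _)%N](_ : _ = false) ?muln0 ?mulr0 //.
    have : (t * (b.+1 - r).+1 <= t * i)%N by rewrite leq_mul2l; lia.
    by rewrite mulnS [(t * i)%N]mulnC; nia.
  have e : (t * (b.+1 - r) = t * (b.+1 - r - i) + t * i)%N by rewrite -mulnDr subnK.
  congr (_ * (_)%:R); rewrite /K mulnSr [(i * t)%N]mulnC e.
  case: leqP => h; first by rewrite muln1; congr 'C(_, _); lia.
  by rewrite muln0 bin_small //; lia.
have -> : \sum_(j < t) (geom t ^+ b.+1)`_(t * (b.+1 - r) + j) * (geom t ^+ a.+1)`_j
    = \sum_(i < (b.+1 - r).+1) (-1) ^+ i * ('C(b.+1, i))%:R *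
        (\sum_(j < t) 'C(j + a, a) * 'C(K i + j, b))%:R.
  under eq_bigr => j _ do rewrite highE lowE mulr_suml.
  rewrite exchange_big /=; apply: eq_bigr => i _.
  rewrite natr_sum mulr_sumr; apply: eq_bigr => j _.
  by rewrite natrM mulrAC -mulrA.
rewrite /phi big_mkord rmorph_sum mulr_sumr; apply: eq_bigr => i _.
rewrite phi_bin_conv_sum //; last by have := ltn_ord i; lia.
rewrite !rmorphM rmorph_sign !rmorph_nat mulrCA; congr (_ * _).
move: (bin_convolution a b (K i) t) (fact_gt0 (a.+1 + b)).
move: (_ `!)%N => f /(congr1 (fun m => m%:R : rat)); rewrite !natrM => e f0.
have fn0 : f%:R != 0 :> rat by rewrite pnatr_eq0 -lt0n.
by apply: (mulfI fn0); rewrite e; field.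
Qed.

(** * Lattice points of the base polytope *)

From mathcomp Require Import finmap.
From mathcomp Require Import classical_sets functions cardinality reals.
From mathcomp Require Import interval_inference convex.

Section LatticePoints.
Variables (R : realType) (n : nat).
Implicit Types (M : matroid 'I_n) (y : 'I_n -> nat).

Lemma conv_hull_convex (X : set 'rV[R]_n) : convex_set (conv_hull X).
Proof.
move=> x y p /set_mem xX /set_mem yX; apply/mem_set => Z ZP.
by apply: set_mem; apply: (ZP.1); apply/mem_set; [exact: (xX Z ZP)|exact: (yX Z ZP)].
Qed.

Lemma base_polytope_rank_ineqs M (x : 'rV[R]_n) : base_polytope M x ->
  \sum_i x ord0 i = (mrank M)%:R /\
  forall A : {set 'I_n}, \sum_(i in A) x ord0 i <= (rk M A)%:R.
Proof.
have indE (A B : {set 'I_n}) :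
    \sum_(i in A) indicator R B ord0 i = #|B :&: A|%:R.
  rewrite -sum1_card natr_sum big_mkcond [RHS]big_mkcond /=.
  apply: eq_bigr => i _; rewrite mxE finset.in_setI.
  by case: (i \in A); case: (i \in B).
pose Q : set 'rV[R]_n := fun x => \sum_i x ord0 i = (mrank M)%:R /\
  forall A : {set 'I_n}, \sum_(i in A) x ord0 i <= (rk M A)%:R.
apply: (@smallest_sub _ _ _ Q) => [u v p /set_mem[u1 uA] /set_mem[v1 vA]|_ [B bB <-]].
  have E (P : pred 'I_n) : \sum_(i | P i) conv p u v ord0 i =
      p%:num * (\sum_(i | P i) u ord0 i) + (1 - p%:num) * \sum_(i | P i) v ord0 i.
    by rewrite !mulr_sumr -big_split; apply: eq_bigr => i _; rewrite !mxE.
  apply/mem_set; split=> [|A]; rewrite E.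
    by rewrite u1 v1 -mulrDl subrKC mul1r.
  have p0 : 0 <= p%:num by [].
  have q0 : 0 <= 1 - p%:num by rewrite subr_ge0.
  have -> : (rk M A)%:R = p%:num * (rk M A)%:R + (1 - p%:num) * (rk M A)%:R :> R.
    by rewrite -mulrDl subrKC mul1r.
  by rewrite lerD // ler_wpM2l.
move: bB => /=; rewrite basisE => /andP[Bi /eqP Br]; split=> [|A]; last first.
  rewrite indE ler_nat; apply: card_indep_le_rk (finset.subsetIr _ _).
  by apply: indepS Bi; exact: finset.subsetIl.
have := indE [set: 'I_n]%SET B; rewrite finset.setIT Br => <-.
by apply: eq_bigl => i; rewrite inE.
Qed.

Lemma rank_ineqs_base_polytope M t y : (0 < t)%N -> rank_ineqs M t y ->
  base_polytope M (\row_i ((y i)%:R / t%:R) : 'rV[R]_n).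
Proof.
move=> t0; have tn0 : t%:R != 0 :> R by rewrite pnatr_eq0 -lt0n.
move: y; apply: rank_ineqs_ind => [y yM y0t|y z w k l k0 l0 zP wP yE].
  have [B bB yE] := rank_ineqs_vertex t0 yM y0t.
  apply: sub_gen_smallest; exists B => //.
  by apply/rowP => i; rewrite !mxE yE natrM mulrC mulKf.
have kl0 : 0 < (k + l)%:R :> R by rewrite ltr0n addn_gt0 k0.
have p0 : 0 <= l%:R / (k + l)%:R :> R by rewrite divr_ge0.
have p1 : l%:R / (k + l)%:R <= 1 :> R.
  by rewrite ler_pdivrMr // mul1r ler_nat leq_addl.
have := @conv_hull_convex _ _ _ (Itv01 p0 p1) (mem_set zP) (mem_set wP).
move=> /set_mem; congr (conv_hull _ _); apply/rowP => i; rewrite !mxE /=.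
have := congr1 (fun m => m%:R : R) (yE i).
rewrite natrM !natrD !natrM => e.
have kl1 : k%:R + l%:R != 0 :> R by rewrite -natrD gt_eqF.
apply: (mulfI kl1); apply: (mulfI tn0).
rewrite /unstable.onem.
have -> : t%:R * ((k%:R + l%:R) * ((y i)%:R / t%:R)) = (k%:R + l%:R) * (y i)%:R :> R by field.
by rewrite -e; field; rewrite tn0.
Qed.

Lemma ehrE M t :
  ehr R M t = #|[set y : {ffun 'I_n -> 'I_t.+1} | rank_ineqs M t (fun i => y i)]%SET|.
Proof.
pose f (y : {ffun 'I_n -> 'I_t.+1}) : 'rV[R]_n := \row_i (y i)%:R.
have f_inj : injective f.
  move=> y z /rowP yz; apply/ffunP => i; apply/val_inj/eqP.
  by rewrite -(eqr_nat R); have := yz i; rewrite !mxE => ->.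
rewrite /ehr; set S := (X in fset_set X).
have -> : S = [set f y | y in [set` [set y : {ffun 'I_n -> 'I_t.+1} |
                                   rank_ineqs M t (fun i => y i)]%SET]]%classic.
  rewrite /S; apply/seteqP; split => [_ [[x xP <-] [z _ zE]]|].
    have [xr xA] := base_polytope_rank_ineqs xP.
    have x01 := base_polytope_box xP.
    have zx i : (z ord0 i)%:~R = t%:R * x ord0 i by move/rowP/(_ i): zE; rewrite !mxE.
    have z0 i : 0 <= z ord0 i.
      by rewrite -(ler0z R) zx mulr_ge0 //; case/andP: (x01 i).
    have absz i : (`|z ord0 i|%N)%:R = t%:R * x ord0 i.
      by rewrite natr_absz ger0_norm.
    have zt i : (`|z ord0 i| < t.+1)%N.
      by rewrite ltnS -(ler_nat R) absz ler_piMr //; case/andP: (x01 i).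
    exists [ffun i => inord `|z ord0 i|%N].
      rewrite /= inE; apply/rank_ineqsP; split=> [|A].
        apply/eqP; rewrite -(eqr_nat R) natrM -xr natr_sum mulr_sumr; apply/eqP.
        by apply: eq_bigr => i _; rewrite ffunE inordK.
      rewrite -(ler_nat R) natrM natr_sum.
      under eq_bigr => i _ do rewrite ffunE inordK // absz.
      by rewrite -mulr_sumr ler_wpM2l.
    by apply/rowP => i; rewrite !mxE ffunE inordK // absz.
  move=> _ [y /= + <-]; rewrite inE => yM; split; last first.
    by exists (\row_i (y i)%:Z) => //; apply/rowP => i; rewrite !mxE.
  (* Division by [t] is meaningless at [t = 0]; there [y] is zero and any basis gives a point of the
     polytope to dilate. *)
  have [t0|t0] := posnP t; last first.
    exists (\row_i ((y i)%:R / t%:R)); first exact: (rank_ineqs_base_polytope t0 yM).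
    by apply/rowP => i; rewrite !mxE mulrC divfK // pnatr_eq0 -lt0n.
  have [B bB] := basis_exists M.
  exists (indicator R B); first by apply: sub_gen_smallest; exists B.
  have tR0 : t%:R = 0 :> R by rewrite t0.
  apply/rowP => i; rewrite !mxE tR0 mul0r.
  by have := rank_ineqs_le i yM; rewrite [X in (_ <= X)%N]t0 leqn0 => /eqP ->.
rewrite fset_set_image // card_imfset //= cardE.
apply/perm_size/uniq_perm; rewrite ?fset_uniq ?enum_uniq // => y.
rewrite mem_enum in_fset_set //.
by apply/idP/idP => [/set_mem|/mem_set].
Qed.

End LatticePoints.

(** * Uniform matroids and the final count *)

Lemma rank_ineqs_uniform n r t (y : 'I_n -> nat) : (r <= n)%N -> (forall i, y i <= t)%N ->
  rank_ineqs (uniform n r) t y = (\sum_i y i == t * r)%N.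
Proof.
move=> rn yt.
have rkU (A : {set 'I_n}) : (minn #|A| r <= rk (uniform n r) A)%N.
  have [B BA cB] := exists_subset_card (geq_minl #|A| r).
  by rewrite -cB; apply: card_indep_le_rk => //; rewrite inE cB geq_minr.
have rU : mrank (uniform n r) = r.
  apply/eqP; rewrite eqn_leq; apply/andP; split.
    by apply/rk_leP => I; rewrite inE.
  by apply: leq_trans (rkU _); rewrite cardsT card_ord leq_min rn leqnn.
rewrite -{2}rU; apply/rank_ineqsP/eqP => [[]//|yr]; split => // A.
rewrite rU in yr.
apply: leq_trans (leq_mul (leqnn t) (rkU A)).
have : (\sum_(i in A) y i <= t * r)%N by rewrite -yr [leqRHS](bigID (mem A)) /= leq_addr.
by have := sum_le_card A yt; rewrite /minn; case: ifP.
Qed.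


Theorem theorem5p10 (R : realType) (n r : nat) (M : matroid 'I_n)
    (rankM : mrank M = r) (pavM : paving M) (t : nat) :
  (ehr R M t)%:R =
  (ehr R (uniform n r) t)%:R -
    \sum_(r <= s < n)
      #|hyperplanes_of_size M s|%:R * ((n - s)%:R / ((n - 1)`!)%:R) *
      binz (t%:Z - 1 + n%:Z - s%:Z) (n - s) * phi r s n t :> rat.
Proof.
have rn : (r <= n)%N.
  by rewrite -rankM (leq_trans (rk_le_card _ _)) // cardsT card_ord.
have unifE : ehr R (uniform n r) t =
    #|[set y : {ffun 'I_n -> 'I_t.+1} | (\sum_i y i == t * r)%N]%SET|.
  rewrite ehrE; apply: eq_card => y; rewrite !inE rank_ineqs_uniform // => i.
  by rewrite -ltnS.
rewrite unifE -rankM card_paving_vectors // rankM ehrE natrD.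
apply/eqP; rewrite eq_sym subr_eq; apply/eqP; congr (_ + _).
rewrite natr_sum.
pose N H : rat := #|[set y : {ffun 'I_n -> 'I_t.+1} |
        (\sum_i y i == t * r)%N & exceeds M t H (fun i => y i)]%SET|%:R.
have NE H s : hyperplane M H -> #|H| = s -> (r <= s < n)%N ->
   N H = (n - s)%:R / ((n - 1)`!)%:R * binz (t%:Z - 1 + n%:Z - s%:Z) (n - s) * phi r s n t.
  (* The mere existence of a hyperplane forces positive rank. *)
  move=> hH Hs /andP[rs sn]; have r0 : (0 < r)%N.
    by case/andP: hH => _; rewrite rankM => /eqP <-.
  rewrite -excess_count_formula ?r0 //.
  have -> : (n - s = #|~: H|)%N by rewrite cardsCs finset.setCK card_ord Hs.
  rewrite -Hs -card_excess ?r0 ?Hs // /N /exceeds rankM.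
  by rewrite rmorph_nat.
(* Hyperplanes are grouped by size: each has fewer than [n] elements, and those with fewer than [r]
   elements are never exceeded and contribute zero. *)
transitivity (\sum_(H | hyperplane M H) \sum_(r <= s < n | s == #|H|) N H).
  apply: eq_bigr => H hH; rewrite big_nat1_eq.
  have Hn : (#|H| < n)%N by have := hyperplane_card_lt hH; rewrite card_ord.
  case: ifP => // /negbT; rewrite Hn andbT -ltnNge => Hr.
  rewrite /N eq_card0 // => y; rewrite !inE small_not_exceeds ?andbF ?rankM // => k.
  by rewrite -ltnS.
rewrite (exchange_big_dep xpredT) //= big_nat [RHS]big_nat.
apply: eq_bigr => s rsn; rewrite -!mulrA mulr_natl -sumr_const.
rewrite (eq_bigl [in hyperplanes_of_size M s]) => [|H]; last by rewrite inE eq_sym.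
by apply: eq_bigr => H; rewrite inE => /andP[hH /eqP Hs]; rewrite (NE H s) // !mulrA.
Qed.
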